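(* The category $\mathcal Top^{\mathcal G}$ of virtual topological superspaces is isomorphic to a full subcategory of the category of topological $\mathcal E_\infty$-spaces.
   Context: Fix a field $k$. ''Graded'' means $\mathbb Z/2$-graded; algebras are associative and unital over $k$. $\wedge(q)$ denotes the exterior (Grassmann) algebra over $k$ on $q$ odd generators $\xi_1,\dots,\xi_q$, graded by parity of degree. $\mathcal G$ is the category of the Grassmann algebras $\wedge(q)$, $q\in\mathbb N$ (with $0\in\mathbb N$), and grading-preserving unital algebra homomorphisms. A virtual topological superspace is a covariant functor from $\mathcal G$ to the category $\mathcal Top$ of topological spaces and continuous maps; $\mathcal Top^{\mathcal G}$ is the category of such functors and natural transformations. $\wedge(\infty)=\bigcup_n\wedge(n)$ is the Grassmann algebra on a countably infinite set $\xi_1,\xi_2,\dots$ of odd generators, with $\wedge(n)$ identified with the subalgebra generated by $\xi_1,\dots,\xi_n$. $\mathcal E_\infty$ is the semigroup, under composition, of all grading-preserving unital algebra endomorphisms $f$ of $\wedge(\infty)$ with finite-dimensional range (equivalently, $f(\wedge(\infty))\subseteq\wedge(n)$ for some $n$). A topological $\mathcal E_\infty$-space is a topological space with an action of the (discrete) semigroup $\mathcal E_\infty$ by continuous self-maps, i.e. $(gh)(x)=g(h(x))$; morphisms are continuous $\mathcal E_\infty$-equivariant maps. *)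

(* Defs.v *)
From HB Require Import structures.
From mathcomp Require Import all_boot all_order all_algebra finmap.
From mathcomp Require Import boolp classical_sets functions wochoice topology_structure.
From mathcomp Require Import monalg.

Set Implicit Arguments.
Unset Strict Implicit.
Unset Printing Implicit Defensive.

Import Order.TTheory GRing.Theory.

Local Open Scope ring_scope.

Local Obligation Tactic := idtac.

(* The exterior algebra over [k] on generators indexed by the totally ordered
   set [I] has as basis the monomials [xi_A = xi_{a_1} ... xi_{a_r}], where
   [A = {a_1 < ... < a_r}] is a finite subset of [I], and
   [xi_A xi_B = (-1)^inv(A, B) xi_(A U B)] if [A] and [B] are disjoint, and [0]
   otherwise, where [inv(A, B)] is the number of pairs [(a, b)] in [A x B] with
   [b < a].  The type ['I_q] of generators gives [wedge(q)], and [nat] gives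
   [wedge(oo)]. *)
Definition grassmann (k : fieldType) (d : Order.disp_t) (I : orderType d) :=
  {malg k[{fset I}]}.

HB.instance Definition _ (k : fieldType) d (I : orderType d) :=
  GRing.Lmodule.on (grassmann k I).

Section GrassmannRing.
Context (k : fieldType) (d : Order.disp_t) (I : orderType d).
Implicit Types (A B C : {fset I}) (f g h : grassmann k I).

Definition inversions A B : nat := \sum_(a <- A) \sum_(b <- B) (b < a)%O.

Definition monomial_sign A B : k :=
  if [disjoint A & B]%fset then (-1) ^+ inversions A B else 0.

Definition grassmann_one : grassmann k I := mkmalgU fset0 1.

Definition grassmann_mul f g : grassmann k I :=
  \sum_(A <- msupp f) \sum_(B <- msupp g)
     mkmalgU (A `|` B)%fset (mcoeff A f * mcoeff B g * monomial_sign A B).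

Lemma inversions0l B : inversions fset0 B = 0%N.
Proof. by rewrite /inversions big_seq_fset0. Qed.

Lemma inversions0r A : inversions A fset0 = 0%N.
Proof. by rewrite /inversions big1 // => a _; rewrite big_seq_fset0. Qed.

Lemma big_fsetU_disjoint A B (F : I -> nat) : [disjoint A & B]%fset ->
  \sum_(a <- (A `|` B)%fset) F a = (\sum_(a <- A) F a + \sum_(b <- B) F b)%N.
Proof.
move=> dAB; rewrite -big_cat; apply: perm_big; apply: uniq_perm => //.
  rewrite cat_uniq !fset_uniq andbT /=; apply/hasPn => x xB.
  by apply/negP => /(fdisjointP dAB); rewrite xB.
by move=> x; rewrite mem_cat in_fsetU.
Qed.

Lemma inversionsUl A B C : [disjoint A & B]%fset ->
  inversions (A `|` B)%fset C = (inversions A C + inversions B C)%N.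
Proof. by move=> dAB; rewrite /inversions big_fsetU_disjoint. Qed.

Lemma inversionsUr A B C : [disjoint B & C]%fset ->
  inversions A (B `|` C)%fset = (inversions A B + inversions A C)%N.
Proof.
move=> dBC; rewrite /inversions -big_split /=.
by apply: eq_bigr => a _; rewrite big_fsetU_disjoint.
Qed.

Lemma monomial_sign0l B : monomial_sign fset0 B = 1.
Proof. by rewrite /monomial_sign fdisjoint0X inversions0l. Qed.

Lemma monomial_sign0r A : monomial_sign A fset0 = 1.
Proof. by rewrite /monomial_sign fdisjointX0 inversions0r. Qed.

Lemma monomial_signA A B C :
  monomial_sign A B * monomial_sign (A `|` B)%fset C =
  monomial_sign B C * monomial_sign A (B `|` C)%fset.
Proof.
rewrite /monomial_sign fdisjointUX fdisjointXU.
case dAB: [disjoint A & B]%fset; case dBC: [disjoint B & C]%fset;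
  case dAC: [disjoint A & C]%fset; rewrite /= ?(mul0r, mulr0) //.
by rewrite inversionsUl // inversionsUr // -!exprD addnA addnC addnCA addnC -addnA addnC.
Qed.

Lemma grassmann_mulw (s t : {fset {fset I}}) f g :
  (msupp f `<=` s)%fset -> (msupp g `<=` t)%fset ->
  grassmann_mul f g = \sum_(A <- s) \sum_(B <- t)
     mkmalgU (A `|` B)%fset (mcoeff A f * mcoeff B g * monomial_sign A B).
Proof.
move=> fs gt; rewrite /grassmann_mul (big_fset_incl _ fs) /=.
  apply: eq_bigr => A _; apply: big_fset_incl => // B _ /mcoeff_outdom ->.
  by rewrite mulr0 mul0r monalgU0.
move=> A _ /mcoeff_outdom fA.
by rewrite big1 // => B _; rewrite fA !mul0r monalgU0.
Qed.

Lemma grassmann_mulDl : left_distributive grassmann_mul +%R.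
Proof.
move=> f g h; have sh := fsubset_refl (msupp h).
rewrite (grassmann_mulw (msuppD_le f g) sh).
rewrite (grassmann_mulw (fsubsetUl (msupp f) (msupp g)) sh).
rewrite (grassmann_mulw (fsubsetUr (msupp f) (msupp g)) sh).
rewrite -big_split; apply: eq_bigr => A _ /=.
rewrite -big_split; apply: eq_bigr => B _ /=.
by rewrite mcoeffD !mulrDl monalgUD.
Qed.

Lemma grassmann_mulDr : right_distributive grassmann_mul +%R.
Proof.
move=> h f g; have sh := fsubset_refl (msupp h).
rewrite (grassmann_mulw sh (msuppD_le f g)).
rewrite (grassmann_mulw sh (fsubsetUl (msupp f) (msupp g))).
rewrite (grassmann_mulw sh (fsubsetUr (msupp f) (msupp g))).
rewrite -big_split; apply: eq_bigr => A _ /=.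
rewrite -big_split; apply: eq_bigr => B _ /=.
by rewrite mcoeffD mulrDr mulrDl monalgUD.
Qed.

Lemma grassmann_mul0l : left_zero 0 grassmann_mul.
Proof. by move=> f; rewrite /grassmann_mul msupp0 big_seq_fset0. Qed.

Lemma grassmann_mul0r : right_zero 0 grassmann_mul.
Proof.
move=> f; rewrite /grassmann_mul big1 // => A _.
by rewrite msupp0 big_seq_fset0.
Qed.

Lemma grassmann_mulUU A B (a b : k) :
  grassmann_mul (mkmalgU A a) (mkmalgU B b) =
  mkmalgU (A `|` B)%fset (a * b * monomial_sign A B).
Proof.
by rewrite (grassmann_mulw msuppU_le msuppU_le) !big_seq_fset1 !mcoeffUU.
Qed.

Lemma grassmann_mul_suml T (r : seq T) (F : T -> grassmann k I) g :
  grassmann_mul (\sum_(i <- r) F i) g = \sum_(i <- r) grassmann_mul (F i) g.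
Proof.
exact: (big_morph (grassmann_mul^~ g)
  (fun _ _ => grassmann_mulDl _ _ _) (grassmann_mul0l _)).
Qed.

Lemma grassmann_mul_sumr T (r : seq T) (F : T -> grassmann k I) g :
  grassmann_mul g (\sum_(i <- r) F i) = \sum_(i <- r) grassmann_mul g (F i).
Proof.
exact: (big_morph (grassmann_mul g)
  (fun _ _ => grassmann_mulDr _ _ _) (grassmann_mul0r _)).
Qed.

Lemma grassmann_mulEl f g : grassmann_mul f g =
  \sum_(A <- msupp f) grassmann_mul (mkmalgU A (mcoeff A f)) g.
Proof. by rewrite -(grassmann_mul_suml (msupp f)) -monalgE. Qed.

Lemma grassmann_mulEr f g : grassmann_mul f g =
  \sum_(B <- msupp g) grassmann_mul f (mkmalgU B (mcoeff B g)).
Proof. by rewrite -(grassmann_mul_sumr (msupp g)) -monalgE. Qed.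

Lemma grassmann_mulA : associative grassmann_mul.
Proof.
move=> f g h; rewrite grassmann_mulEl [in RHS](grassmann_mulEl f g).
rewrite grassmann_mul_suml; apply: eq_bigr => A _.
rewrite [in LHS](grassmann_mulEl g h) grassmann_mul_sumr.
rewrite [in RHS](grassmann_mulEr _ g) grassmann_mul_suml.
apply: eq_bigr => B _.
rewrite (grassmann_mulEr _ h) grassmann_mul_sumr [RHS]grassmann_mulEr.
apply: eq_bigr => C _.
rewrite !grassmann_mulUU fsetUA; congr mkmalgU.
rewrite -!mulrA; congr (_ * (_ * _)).
by rewrite -monomial_signA mulrCA.
Qed.

Lemma grassmann_mul1l : left_id grassmann_one grassmann_mul.
Proof.
move=> f; rewrite grassmann_mulEr [RHS]monalgE; apply: eq_bigr => A _.
by rewrite grassmann_mulUU fset0U mul1r monomial_sign0l mulr1.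
Qed.

Lemma grassmann_mul1r : right_id grassmann_one grassmann_mul.
Proof.
move=> f; rewrite grassmann_mulEl [RHS]monalgE; apply: eq_bigr => A _.
by rewrite grassmann_mulUU fsetU0 monomial_sign0r !mulr1.
Qed.

Lemma grassmann_one_neq0 : grassmann_one != 0.
Proof.
apply/eqP => /(congr1 (mcoeff fset0)); rewrite mcoeffUU mcoeff0 => /eqP.
by rewrite oner_eq0.
Qed.

HB.instance Definition _ := GRing.Zmodule_isNzRing.Build (grassmann k I)
  grassmann_mulA grassmann_mul1l grassmann_mul1r
  grassmann_mulDl grassmann_mulDr grassmann_one_neq0.

Lemma grassmann_scaleU (c : k) A (a : k) :
  c *: (mkmalgU A a : grassmann k I) = mkmalgU A (c * a).
Proof. by apply/malgP => B; rewrite mcoeffZ !mcoeffU mulrnAr. Qed.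

Lemma grassmann_coefZ (c : k) A f : mcoeff A (c *: f) = c * mcoeff A f.
Proof. exact: mcoeffZ. Qed.

Lemma grassmann_scaleAl (c : k) f g : c *: (f * g) = (c *: f) * g.
Proof.
rewrite [RHS](grassmann_mulw (msuppZ_le c f) (fsubset_refl _)) scaler_sumr.
apply: eq_bigr => A _; rewrite scaler_sumr; apply: eq_bigr => B _.
by rewrite grassmann_scaleU grassmann_coefZ !mulrA.
Qed.

Lemma grassmann_scaleAr (c : k) f g : c *: (f * g) = f * (c *: g).
Proof.
rewrite [RHS](grassmann_mulw (fsubset_refl _) (msuppZ_le c g)) scaler_sumr.
apply: eq_bigr => A _; rewrite scaler_sumr; apply: eq_bigr => B _.
by rewrite grassmann_scaleU grassmann_coefZ !mulrA (mulrC c).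
Qed.

HB.instance Definition _ :=
  GRing.Lmodule_isLalgebra.Build k (grassmann k I) grassmann_scaleAl.
HB.instance Definition _ :=
  GRing.Lalgebra_isAlgebra.Build k (grassmann k I) grassmann_scaleAr.

Definition generator (i : I) : grassmann k I := mkmalgU [fset i]%fset 1.

Lemma generator_sq i : generator i * generator i = 0.
Proof.
rewrite [LHS]grassmann_mulUU /monomial_sign.
by rewrite fdisjointX1 inE eqxx mulr0 monalgU0.
Qed.

Lemma generator_anticomm i j :
  generator i * generator j = - (generator j * generator i).
Proof.
have [->|ij] := eqVneq i j; first by rewrite !generator_sq oppr0.
rewrite [LHS]grassmann_mulUU [X in - X]grassmann_mulUU -monalgUN fsetUC.
congr mkmalgU; rewrite /monomial_sign !fdisjointX1 !inE eq_sym (negbTE ij) /=.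
rewrite /inversions !big_seq_fset1 !mul1r.
by case: ltgtP ij => // _ _; rewrite ?opprK.
Qed.

End GrassmannRing.

Section Graded.
Context (k : fieldType).

(* [homogeneous false] and [homogeneous true] are the even and the odd part. *)
Definition homogeneous d (I : orderType d) (b : bool) (x : grassmann k I) :=
  forall A : {fset I}, mcoeff A x != 0 -> odd #|` A| = b.

Record graded_hom d (I : orderType d) d' (J : orderType d') := GradedHom {
  graded_fun :> grassmann k I -> grassmann k J;
  graded_linear : linear graded_fun;
  graded_multiplicative : monoid_morphism graded_fun;
  graded_parity : forall b x, homogeneous b x -> homogeneous b (graded_fun x)
}.

Lemma graded_homP d (I : orderType d) d' (J : orderType d')
  (f g : graded_hom I J) : f =1 g -> f = g.
Proof.
case: f g => [f fl fm fp] [g gl gm gp] /= /funext fg.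
rewrite -{}fg in gl gm gp *.
by congr GradedHom; exact: Prop_irrelevance.
Qed.

Program Definition graded_id d (I : orderType d) : graded_hom I I :=
  @GradedHom _ _ _ _ idfun _ _ _.
Next Obligation. by []. Qed.
Next Obligation. by []. Qed.
Next Obligation. by []. Qed.

Program Definition graded_comp d (I : orderType d) d' (J : orderType d')
    d'' (K : orderType d'') (g : graded_hom J K) (f : graded_hom I J) :
  graded_hom I K := @GradedHom _ _ _ _ (g \o f) _ _ _.
Next Obligation. by move=> ? ? ? ? ? ? g f a x y /=; rewrite !graded_linear. Qed.
Next Obligation.
move=> ? ? ? ? ? ? g f; have [f1 fM] := graded_multiplicative f.
have [g1 gM] := graded_multiplicative g.
by split=> [|x y] /=; rewrite ?f1 ?g1 ?fM ?gM.
Qed.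
Next Obligation. by move=> ? ? ? ? ? ? g f b x hx; do 2 apply: graded_parity. Qed.

End Graded.

Section EndoSemigroup.
Context (k : fieldType).

Definition finite_dim_range (f : grassmann k nat -> grassmann k nat) :=
  exists s : seq (grassmann k nat), forall x,
  exists c : 'I_(size s) -> k, f x = \sum_(i < size s) c i *: s`_i.

Record einf := Einf {
  einf_hom :> graded_hom k nat nat;
  einf_finite : finite_dim_range einf_hom
}.

Program Definition einf_comp (g h : einf) : einf :=
  @Einf (graded_comp g h) _.
Next Obligation.
move=> g h; have [s gs] := einf_finite g.
by exists s => x; exact: gs.
Qed.

End EndoSemigroup.

Record category := Category {
  obj :> Type;
  hom : obj -> obj -> Type;
  idm : forall x, hom x x;
  compm : forall x y z, hom y z -> hom x y -> hom x z;
  comp1m : forall x y (f : hom x y), compm (idm y) f = f;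
  compm1 : forall x y (f : hom x y), compm f (idm x) = f;
  compmA : forall x y z t (h : hom z t) (g : hom y z) (f : hom x y),
    compm h (compm g f) = compm (compm h g) f
}.

Record functor (C D : category) := Functor {
  map_obj :> C -> D;
  map_hom : forall x y : C, hom x y -> hom (map_obj x) (map_obj y);
  map_id : forall x : C, map_hom (idm x) = idm (map_obj x);
  map_comp : forall (x y z : C) (g : hom y z) (f : hom x y),
    map_hom (compm g f) = compm (map_hom g) (map_hom f)
}.

Program Definition functor_id (C : category) : functor C C :=
  @Functor C C (fun x => x) (fun _ _ f => f) _ _.
Next Obligation. by []. Qed.
Next Obligation. by []. Qed.

Program Definition functor_comp (C D E : category)
    (G : functor D E) (F : functor C D) : functor C E :=
  @Functor C E (fun x => G (F x)) (fun _ _ f => map_hom G (map_hom F f)) _ _.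
Next Obligation. by move=> * /=; rewrite !map_id. Qed.
Next Obligation. by move=> * /=; rewrite !map_comp. Qed.

Record nat_trans (C D : category) (F G : functor C D) := NatTrans {
  component :> forall x : C, hom (F x) (G x);
  naturality : forall (x y : C) (f : hom x y),
    compm (component y) (map_hom F f) = compm (map_hom G f) (component x)
}.

Lemma nat_transP (C D : category) (F G : functor C D) (s t : nat_trans F G) :
  (forall x, s x = t x) -> s = t.
Proof.
case: s t => [s sn] [t tn] /= st.
have {}st : s = t by exact: functional_extensionality_dep.
by case: t / st tn => tn; congr NatTrans; exact: Prop_irrelevance.
Qed.

Program Definition nat_trans_id (C D : category) (F : functor C D) :
  nat_trans F F := @NatTrans C D F F (fun x => idm (F x)) _.
Next Obligation. by move=> * /=; rewrite comp1m compm1. Qed.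

Program Definition nat_trans_comp (C D : category) (F G H : functor C D)
    (t : nat_trans G H) (s : nat_trans F G) : nat_trans F H :=
  @NatTrans C D F H (fun x => compm (t x) (s x)) _.
Next Obligation.
by move=> * /=; rewrite -compmA naturality compmA naturality compmA.
Qed.

Program Definition functor_category (C D : category) : category :=
  @Category (functor C D) (@nat_trans C D) (@nat_trans_id C D)
    (@nat_trans_comp C D) _ _ _.
Next Obligation. by move=> *; apply: nat_transP => x /=; rewrite comp1m. Qed.
Next Obligation. by move=> *; apply: nat_transP => x /=; rewrite compm1. Qed.
Next Obligation. by move=> *; apply: nat_transP => x /=; rewrite compmA. Qed.

Program Definition full_subcategory (C : category) (P : C -> Prop) : category :=
  @Category {x : C | P x} (fun x y => hom (sval x) (sval y))
    (fun x => idm (sval x)) (fun _ _ _ g f => compm g f) _ _ _.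
Next Obligation. by move=> *; exact: comp1m. Qed.
Next Obligation. by move=> *; exact: compm1. Qed.
Next Obligation. by move=> *; exact: compmA. Qed.

Definition isomorphic (C D : category) : Prop :=
  exists (F : functor C D) (G : functor D C),
    functor_comp G F = functor_id C /\ functor_comp F G = functor_id D.

(* An isomorphism of categories is bijective on objects, so it depends on what
   it means for two spaces to be equal, hence on equality of their underlying
   sets.  Equality of types is not determined by the theory, so the underlying
   set of a space is taken, as in set theory, to be an element of the cumulative
   hierarchy, where equality is extensional.  The hierarchy is Aczel's: the set
   [Sup A f] has as its elements the [f a], and trees with the same elements are
   identified.  Up to bijection, every type in the universe of [A] is such a set:
   [every_type_is_a_set]. *)
Inductive tree : Type := Sup (A : Type) (f : A -> tree).

Fixpoint tree_eq (s t : tree) : Prop :=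
  let: Sup A f := s in let: Sup B g := t in
  (forall a, exists b, tree_eq (f a) (g b)) /\
  (forall b, exists a, tree_eq (f a) (g b)).

Definition hset : Type := {P : tree -> Prop | exists t, P = tree_eq t}.

Definition hmem (x X : hset) : Prop :=
  exists (A : Type) (f : A -> tree) (a : A), sval X (Sup f) /\ sval x (f a).

Lemma tree_eq_refl t : tree_eq t t.
Proof. by elim: t => A f IH /=; split=> a; exists a. Qed.

Lemma tree_eq_sym s t : tree_eq s t -> tree_eq t s.
Proof.
elim: s t => A f IH [B g] /= [fg gf]; split=> [b|a].
  by have [a /IH] := gf b; exists a.
by have [b /IH] := fg a; exists b.
Qed.

Lemma tree_eq_trans s t u : tree_eq s t -> tree_eq t u -> tree_eq s u.
Proof.
elim: s t u => A f IH [B g] [C h] /= [fg gf] [gh hg]; split=> [a|c].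
  have [b ab] := fg a; have [c bc] := gh b; exists c; exact: IH ab bc.
have [b bc] := hg c; have [a ab] := gf b; exists a; exact: IH ab bc.
Qed.

Definition hset_of (t : tree) : hset := exist _ (tree_eq t) (ex_intro _ t erefl).

Lemma hset_of_eq s t : hset_of s = hset_of t <-> tree_eq s t.
Proof.
split=> [/(congr1 sval) /= ->|st]; first exact: tree_eq_refl.
apply: eq_exist => /=; apply/funext => u; apply/propext.
by split; apply: tree_eq_trans => //; exact: tree_eq_sym.
Qed.

Lemma hset_of_surj X : exists t, X = hset_of t.
Proof. by case: X => P [t Pt]; exists t; apply: eq_exist. Qed.

Lemma hmemE A (f : A -> tree) x :
  hmem x (hset_of (Sup f)) <-> exists a, x = hset_of (f a).
Proof.
have [t ->] := hset_of_surj x; split.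
  move=> [B [g [b [/= [_ gf] tb]]]]; have [a ab] := gf b; exists a.
  by apply/hset_of_eq; apply: tree_eq_trans tb (tree_eq_sym ab).
move=> [a /hset_of_eq ta]; exists A, f, a; split=> //; exact: tree_eq_refl.
Qed.

Lemma hset_ext X Y : (forall x, hmem x X <-> hmem x Y) -> X = Y.
Proof.
have [[A f] ->] := hset_of_surj X; have [[B g] ->] := hset_of_surj Y => XY.
apply/hset_of_eq; split=> [a|b].
  have /XY/hmemE[b /hset_of_eq ab] : hmem (hset_of (f a)) (hset_of (Sup f)).
    by apply/hmemE; exists a.
  by exists b.
have /XY/hmemE[a /hset_of_eq ab] : hmem (hset_of (g b)) (hset_of (Sup g)).
  by apply/hmemE; exists b.
by exists a; exact: tree_eq_sym.
Qed.

Lemma hset_range (A : Type) (F : A -> hset) :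
  exists X, forall x, hmem x X <-> exists a, F a = x.
Proof.
have /choice[f fE] a : exists t, F a = hset_of t by exact: hset_of_surj.
exists (hset_of (Sup f)) => x; rewrite hmemE.
by split=> -[a]; [move=> ->|move=> <-]; exists a; rewrite fE.
Qed.

Lemma every_type_is_a_set (A : Type) :
  exists (X : hset) (F : A -> {x | hmem x X}), bijective F.
Proof.
have [R0 Rwo] := well_ordering_principle {classic A}.
pose R (x y : A) : Prop := R0 x y.
pose lt (x y : A) : Prop := R x y /\ x <> y.
have Rmin (P : A -> Prop) : (exists x, P x) ->
    exists2 z : A, P z & forall y, P y -> R z y.
  move=> [x Px]; have [|z [[zP zmin] _]] := Rwo [pred x | `[< P x >]].
    by exists x; exact/asboolP.
  exists z; first exact/asboolP.
  by move=> y Py; apply: zmin; apply/asboolP.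
have Ranti (x y : A) : R x y -> R y x -> x = y.
  move=> xy yx; apply: (@wo_chain_antisymmetric {classic A} R0 predT) => //.
    by move=> P _; exact: Rwo.
  by apply/andP.
have lt_wf : well_founded lt.
  move=> x; apply: contrapT => xN.
  have [z zN zmin] := Rmin (fun x => ~ Acc lt x) (ex_intro _ x xN).
  apply: zN; constructor => y [Ryz yz]; apply: contrapT => yN.
  by apply: yz; apply: Ranti (zmin y yN).
pose step x (rec : forall y, lt y x -> tree) :=
  Sup (fun y : {y | lt y x} => rec (sval y) (svalP y)).
pose h := Fix lt_wf (fun=> tree) step.
have hE x : h x = Sup (fun y : {y | lt y x} => h (sval y)).
  rewrite /h Fix_eq //; rewrite /step => {}x f g fg; congr Sup.
  by apply/funext => y; exact: fg.
have h_lt x y : lt x y -> ~ tree_eq (h x) (h y).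
  move: x y; apply: (well_founded_ind lt_wf) => x IH y xy; rewrite (hE x) (hE y).
  move=> [_ /(_ (exist _ x xy))] [[z zx] /= zxE].
  exact: (IH z zx x zx zxE).
have h_inj x y : tree_eq (h x) (h y) -> x = y.
  move=> xyE; apply: contrapT => xy.
  have [z zxy zmin] := Rmin (fun z => z = x \/ z = y)
    (ex_intro _ x (or_introl erefl)).
  have [zx zy] := (zmin x (or_introl erefl), zmin y (or_intror erefl)).
  case: zxy => ?; subst z.
    exact: h_lt xyE.
  by apply: h_lt (tree_eq_sym xyE); split=> // /esym.
have hX (a : A) : hmem (hset_of (h a)) (hset_of (Sup (fun a : A => h a))).
  by apply/hmemE; exists a.
pose X := hset_of (Sup (fun a : A => h a)).
pose F a := exist (fun x => hmem x X) _ (hX a).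
have /choice[G GK] (x : {x | hmem x X}) : exists a, F a = x.
  by case: x => x xX; have /hmemE[a xa] := xX; exists a; apply: eq_exist.
exists X, F; exists G => // a.
by have /(congr1 sval)/hset_of_eq/h_inj := GK (F a).
Qed.

Record space := Space {
  carrier : hset;
  sopen : set_system {x : hset | hmem x carrier};
  sopenT : sopen setT;
  sopenI : setI_closed sopen;
  sopen_bigU : forall (I : Type) (f : I -> set {x : hset | hmem x carrier}),
    (forall i, sopen (f i)) -> sopen (\bigcup_i f i)%classic
}.

Definition points (S : space) : Type := {x : hset | hmem x (carrier S)}.
Coercion points : space >-> Sortclass.

HB.instance Definition _ (S : space) := gen_eqMixin (points S).
HB.instance Definition _ (S : space) := gen_choiceMixin (points S).
HB.instance Definition _ (S : space) :=
  isOpenTopological.Build (points S) (@sopenT S) (@sopenI S) (@sopen_bigU S).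

Program Definition top_category : category :=
  @Category space (fun X Y => continuousType (points X) (points Y))
    (fun X => (idfun : continuousType (points X) (points X)))
    (fun X Y Z (g : continuousType (points Y) (points Z))
       (f : continuousType (points X) (points Y)) =>
       (g \o f : continuousType (points X) (points Z))) _ _ _.
Next Obligation. by move=> *; apply/continuousEP. Qed.
Next Obligation. by move=> *; apply/continuousEP. Qed.
Next Obligation. by move=> *; apply/continuousEP. Qed.

Section Superspaces.
Context (k : fieldType).

(* The object [q] stands for [wedge(q)]. *)
Program Definition grassmann_category : category :=
  @Category nat (fun p q => graded_hom k 'I_p 'I_q)
    (fun p => graded_id k 'I_p) (fun _ _ _ g f => graded_comp g f) _ _ _.
Next Obligation. by move=> *; apply: graded_homP. Qed.
Next Obligation. by move=> *; apply: graded_homP. Qed.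
Next Obligation. by move=> *; apply: graded_homP. Qed.

Definition virtual_superspace_category : category :=
  functor_category grassmann_category top_category.

Record einf_space := EinfSpace {
  einf_sort :> space;
  act : einf k -> continuousType (points einf_sort) (points einf_sort);
  act_comp : forall g h x, act (einf_comp g h) x = act g (act h x)
}.

Arguments act : clear implicits.

Record einf_map (X Y : einf_space) := EinfMap {
  einf_fun :> continuousType (points X) (points Y);
  einf_equivariant : forall g x, einf_fun (act X g x) = act Y g (einf_fun x)
}.

Lemma einf_mapP (X Y : einf_space) (f g : einf_map X Y) :
  f =1 g -> f = g.
Proof.
case: f g => [f fe] [g ge] /= fg.
have {}fg : f = g by apply/continuousEP.
rewrite -{}fg in ge *; congr EinfMap; exact: Prop_irrelevance.
Qed.

Program Definition einf_map_id (X : einf_space) : einf_map X X :=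
  @EinfMap X X (idm (X : top_category)) _.
Next Obligation. by []. Qed.

Program Definition einf_map_comp (X Y Z : einf_space)
    (g : einf_map Y Z) (f : einf_map X Y) : einf_map X Z :=
  @EinfMap X Z (compm (einf_fun g : @hom top_category Y Z)
                      (einf_fun f : @hom top_category X Y)) _.
Next Obligation. by move=> * /=; rewrite !einf_equivariant. Qed.

Program Definition einf_space_category : category :=
  @Category einf_space einf_map einf_map_id einf_map_comp _ _ _.
Next Obligation. by move=> *; apply: einf_mapP. Qed.
Next Obligation. by move=> *; apply: einf_mapP. Qed.
Next Obligation. by move=> *; apply: einf_mapP. Qed.

End Superspaces.

(* Main.v *)
From HB Require Import structures.
From Stdlib Require Import Eqdep.
From mathcomp Require Import all_boot all_order all_algebra finmap.
From mathcomp Require Import boolp classical_sets functions topology_structure.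
From mathcomp Require Import monalg.
Require Import Defs.

(** A functor [F] extends to [wedge(oo)] by the topological colimit [colim F] of
    the spaces [F(wedge(n))] along the inclusions.  An endomorphism [f] of
    [wedge(oo)] with finite-dimensional range takes values in some [wedge(N)], so
    it acts on the colimit by continuous maps, through [F(wedge(N))].  This gives
    a functor to the spaces with an action of the semigroup ([colim_functor]).

    Inclusions of Grassmann algebras have retractions, which kill the superfluous
    generators.  So [F(wedge(n))] is a continuous retract of the colimit, namely
    the image of the projector [e_n] of [wedge(oo)] onto [wedge(n)], which
    belongs to the semigroup; and every homomorphism [h] from [wedge(m)] to
    [wedge(n)] is the restriction of an element of the semigroup, which acts on
    the retracts as [F(h)] ([colim_act_einf_of]).  A continuous equivariant map of
    colimits therefore restricts to the retracts, where it is a natural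
    transformation, and it is determined by the restrictions: the functor is
    fully faithful ([colim_einf_map_full], [colim_einf_map_faithful]).

    An isomorphism onto the full subcategory on the image also needs injectivity
    on objects ([isomorphic_full_image]), and this depends on which sets the
    colimits are.  A point [x] of the colimit is determined by its retractions
    [x_n] to the stages, and it is realized as the set coding the sequence
    [(x_n)].  Then the stage [F(wedge(n))] is, as a set, the set of the [n]-th
    coordinates of the points; its topology is recovered because it is a
    continuous retract, and the maps [F(h)] are recovered from the action
    ([colim_einf_space_inj]). *)

Set Implicit Arguments.
Unset Strict Implicit.
Unset Printing Implicit Defensive.

Import Order.TTheory GRing.Theory.
Local Open Scope ring_scope.

(** * Monotone substitutions of generators *)

Section MonomialSubstitution.
Context (k : fieldType) (d : Order.disp_t) (I : orderType d).
Context (d' : Order.disp_t) (J : orderType d').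
Implicit Types (A B : {fset I}) (f g : grassmann k I).

Definition partial_monotone (p : I -> option J) :=
  forall i i' j j', p i = Some j -> p i' = Some j' -> (i < i')%O = (j < j')%O.

Variable p : I -> option J.
Hypothesis p_mono : partial_monotone p.

Lemma partial_monotone_inj i i' j : p i = Some j -> p i' = Some j -> i = i'.
Proof.
move=> pi pi'; have := p_mono pi pi'; have := p_mono pi' pi.
by rewrite ltxx; case: ltgtP.
Qed.

(** [seq_fset] discards the order of the list, and [pmap] the generators on which
    [p] is undefined, so this is the image of the part of [A] in the domain. *)
Definition partial_image A : {fset J} := seq_fset tt (pmap p A).

Lemma partial_imageP A j :
  reflect (exists2 i, i \in A & p i = Some j) (j \in partial_image A).
Proof.
rewrite seq_fsetE mem_pmap; apply: (iffP mapP) => -[i iA pi]; by exists i.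
Qed.

Lemma pmap_monotone_uniq (s : seq I) : uniq s -> uniq (pmap p s).
Proof.
elim: s => //= i s IH /andP[iNs /IH s_uniq]; case pi: (p i) => [j|] //=.
rewrite s_uniq andbT mem_pmap; apply: contra iNs => /mapP[i' i's /esym pi'].
by rewrite (partial_monotone_inj pi pi').
Qed.

Lemma big_partial_image A (F : J -> nat) :
  (\sum_(j <- partial_image A) F j = \sum_(i <- A) oapp F 0 (p i))%N.
Proof.
have pA : perm_eq (partial_image A) (pmap p A).
  apply: uniq_perm; rewrite ?pmap_monotone_uniq ?fset_uniq //.
  by move=> j; rewrite seq_fsetE.
rewrite (perm_big _ pA) {pA} /=.
elim: (A : seq I) => [|i s IH]; first by rewrite !big_nil.
by rewrite big_cons /= -IH; case: (p i) => [j|] //=; rewrite big_cons.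
Qed.

Lemma all_domain A i : all p A -> i \in A -> exists j, p i = Some j.
Proof. by move=> /allP/(_ i) + iA => /(_ iA); case: (p i) => // j; exists j. Qed.

Lemma card_partial_image A : all p A -> #|` partial_image A| = #|` A|.
Proof.
move=> pA; rewrite -!sum1_size big_partial_image big_seq [RHS]big_seq.
by apply: eq_bigr => i /(all_domain pA)[j ->].
Qed.

Lemma partial_imageU A B :
  partial_image (A `|` B)%fset = (partial_image A `|` partial_image B)%fset.
Proof.
apply/fsetP => j; rewrite in_fsetU; apply/partial_imageP/orP.
  by move=> [i]; rewrite in_fsetU => /orP[] iAB pi; [left|right];
    apply/partial_imageP; exists i.
by move=> [] /partial_imageP[i iA pi]; exists i => //; rewrite in_fsetU iA ?orbT.
Qed.

(** The sign depends only on the relative order of the generators, which [p]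
    preserves; hence the substitution below, which involves no signs, is
    multiplicative. *)
Lemma monomial_sign_partial_image A B : all p A -> all p B ->
  monomial_sign k (partial_image A) (partial_image B) = monomial_sign k A B.
Proof.
move=> pA pB; rewrite /monomial_sign.
have -> : [disjoint partial_image A & partial_image B]%fset =
          [disjoint A & B]%fset.
  apply/fdisjointP/fdisjointP => dAB => [i iA|j /partial_imageP[i iA pi]].
    have [j pi] := all_domain pA iA.
    have /dAB : j \in partial_image A by apply/partial_imageP; exists i.
    by apply: contra => iB; apply/partial_imageP; exists i.
  apply/partial_imageP => -[i' i'B pi'].
  by have := dAB _ iA; rewrite (partial_monotone_inj pi pi') i'B.
case: ifP => // _; congr (_ ^+ _).
rewrite /inversions big_partial_image big_seq [RHS]big_seq; apply: eq_bigr => i.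
move=> /(all_domain pA)[j pi]; rewrite pi /= big_partial_image big_seq.
rewrite [RHS]big_seq; apply: eq_bigr => i' /(all_domain pB)[j' pi'].
by rewrite pi' /= (p_mono pi' pi).
Qed.

Definition substitute_monomial A : grassmann k J :=
  if all p A then mkmalgU (partial_image A) 1 else 0.

Lemma substitute_monomialM A B :
  substitute_monomial A * substitute_monomial B =
  monomial_sign k A B *: substitute_monomial (A `|` B)%fset.
Proof.
rewrite /substitute_monomial.
have -> : all p (A `|` B)%fset = all p A && all p B.
  rewrite -all_cat; apply: eq_all_r => i; by rewrite in_fsetU mem_cat.
case pA: (all p A); last by rewrite mul0r scaler0.
case pB: (all p B); last by rewrite mulr0 scaler0.
rewrite [LHS]grassmann_mulUU monomial_sign_partial_image // partial_imageU.
by rewrite grassmann_scaleU !mulr1 mul1r.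
Qed.

(** The substitution [xi_i |-> xi_(p i)], with [xi_i |-> 0] where [p] is undefined.
    One partial map serves both the inclusions of Grassmann algebras (where it is
    total) and the retractions that kill the generators of large index. *)
Definition substitute f : grassmann k J :=
  \sum_(A <- msupp f) mcoeff A f *: substitute_monomial A.

Lemma substitutew (s : {fset {fset I}}) f : (msupp f `<=` s)%fset ->
  substitute f = \sum_(A <- s) mcoeff A f *: substitute_monomial A.
Proof.
move=> fs; apply: big_fset_incl => // A _ /mcoeff_outdom ->.
by rewrite scale0r.
Qed.

Lemma substitute_linear : linear substitute.
Proof.
move=> a f g; pose s := (msupp f `|` msupp g)%fset.
have fs : (msupp f `<=` s)%fset by rewrite fsubsetUl.
have gs : (msupp g `<=` s)%fset by rewrite fsubsetUr.
have afs := fsubset_trans (msuppZ_le a f) fs.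
rewrite (substitutew fs) (substitutew gs) (@substitutew s); last first.
  by apply: fsubset_trans (msuppD_le _ _) _; rewrite fsubUset afs gs.
rewrite scaler_sumr -big_split; apply: eq_bigr => A _ /=.
by rewrite mcoeffD grassmann_coefZ scalerDl scalerA.
Qed.

HB.instance Definition _ := GRing.isLinear.Build k (grassmann k I)
  (grassmann k J) _ substitute substitute_linear.

Lemma substituteU A (a : k) :
  substitute (mkmalgU A a) = a *: substitute_monomial A.
Proof. by rewrite (substitutew msuppU_le) big_seq_fset1 mcoeffUU. Qed.

Lemma grassmannE f : f = \sum_(A <- msupp f) mkmalgU A (mcoeff A f).
Proof. exact: monalgE. Qed.

Lemma substitute_multiplicative : monoid_morphism substitute.
Proof.
split=> [|f g].
  rewrite [substitute _]substituteU scale1r /substitute_monomial.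
  have -> : all p (fset0 : {fset I}) by apply/allP => i.
  congr mkmalgU; apply/fsetP => j; rewrite in_fset0.
  by apply/partial_imageP => -[i].
rewrite {1}(grassmannE f) {1}(grassmannE g) mulr_suml linear_sum /=.
rewrite [substitute f]/substitute mulr_suml; apply: eq_bigr => A _.
rewrite mulr_sumr linear_sum /= [substitute g]/substitute mulr_sumr.
apply: eq_bigr => B _.
rewrite [X in substitute X]grassmann_mulUU substituteU -scalerAl -scalerAr.
by rewrite substitute_monomialM !scalerA.
Qed.

Lemma substitute_parity b f : homogeneous b f -> homogeneous b (substitute f).
Proof.
move=> hf B; rewrite raddf_sum /= => fB.
have [A [fA]] : exists A, mcoeff A f != 0 /\
    mcoeff B (substitute_monomial A) != 0.
  apply: contrapT => noA; case/eqP: fB; apply: big1 => A _.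
  rewrite grassmann_coefZ; apply/eqP; rewrite mulf_eq0 -implyNb.
  apply/implyP => fA; apply/negP => BA; apply: noA.
  by exists A; split=> //; exact/negP.
rewrite /substitute_monomial; case: ifP => [pA|]; last by rewrite mcoeff0 eqxx.
rewrite mcoeffU; case: (_ =P B) => [<- _|_]; last by rewrite eqxx.
by rewrite card_partial_image // hf.
Qed.

Definition substitution : graded_hom k I J :=
  GradedHom substitute_linear substitute_multiplicative substitute_parity.

End MonomialSubstitution.

Section Substitutions.
Context (k : fieldType) (d : Order.disp_t) (I : orderType d).

(** Composition of substitutions is composition of partial maps of the
    generators: the identities between inclusions and projections thus reduce to
    identities between partial maps of indices. *)
Lemma substitute_comp d' (J : orderType d') d'' (K : orderType d'')
    (q : J -> option K) (p : I -> option J) (f : grassmann k I) :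
  substitute q (substitute p f) = substitute (fun i => obind q (p i)) f.
Proof.
rewrite [substitute p f]/substitute linear_sum; apply: eq_bigr => A _.
rewrite linearZ /=; congr (_ *: _); rewrite /substitute_monomial.
have -> : all (fun i => obind q (p i)) A = all p A && all q (partial_image p A).
  apply/allP/andP => [rA|[pA /allP qA] i iA].
    split; apply/allP; first by move=> i /rA; case: (p i).
    by move=> j /partial_imageP[i /rA + pi]; rewrite pi.
  have [j pi] := all_domain pA iA; rewrite pi; apply: qA.
  by apply/partial_imageP; exists i.
case: ifP => pA /=; last by rewrite linear0.
rewrite substituteU scale1r /substitute_monomial; case: ifP => // _.
congr mkmalgU; apply/fsetP => x; apply/partial_imageP/partial_imageP.
  by move=> [j /partial_imageP[i iA pi] qj]; exists i; rewrite ?pi.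
move=> [i iA]; have [j pi] := all_domain pA iA; rewrite pi /= => qj.
by exists j => //; apply/partial_imageP; exists i.
Qed.

Lemma substitute_fix (p : I -> option I) (f : grassmann k I) :
  (forall A i, A \in msupp f -> i \in A -> p i = Some i) -> substitute p f = f.
Proof.
move=> pf; rewrite [RHS]grassmannE /substitute big_seq [RHS]big_seq.
apply: eq_bigr => A fA; rewrite /substitute_monomial.
have -> : all p A by apply/allP => i iA; rewrite (pf _ _ fA iA).
rewrite grassmann_scaleU mulr1; congr mkmalgU; apply/fsetP => j.
apply/partial_imageP/idP => [[i iA]|jA]; last first.
  by exists j; rewrite // (pf _ _ fA jA).
by rewrite (pf _ _ fA iA) => -[<-].
Qed.

End Substitutions.

(** * Inclusions and truncations of Grassmann algebras *)

Section GradedHomLinearity.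
Context (k : fieldType) (d : Order.disp_t) (I : orderType d).
Context (d' : Order.disp_t) (J : orderType d') (f : graded_hom k I J).

HB.instance Definition _ :=
  GRing.isLinear.Build k (grassmann k I) (grassmann k J) _ (graded_fun f)
    (graded_linear f).

Lemma graded_homZ (a : k) (x : grassmann k I) : f (a *: x) = a *: f x.
Proof. exact: linearZ. Qed.

Lemma graded_hom_sum (T : Type) (r : seq T) (F : T -> grassmann k I) :
  f (\sum_(i <- r) F i) = \sum_(i <- r) f (F i).
Proof. exact: linear_sum. Qed.

End GradedHomLinearity.

Lemma graded_compE (k : fieldType) d (I : orderType d) d' (J : orderType d')
    d'' (K : orderType d'') (g : graded_hom k J K) (f : graded_hom k I J) x :
  graded_comp g f x = g (f x).
Proof. by []. Qed.

Section Truncations.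
Context (k : fieldType).
Implicit Types (m n : nat).

Lemma inclusion_monotone n :
  partial_monotone (fun i : 'I_n => Some (i : nat)).
Proof. by move=> i i' j j' [<-] [<-]. Qed.

Lemma projection_monotone n : partial_monotone (insub : nat -> option 'I_n).
Proof.
move=> i i' j j'; case: insubP => // u _ <- [<-].
by case: insubP => // u' _ <- [<-].
Qed.

(** [inclusion n] identifies [wedge(n)] with the subalgebra of [wedge(oo)] on the
    first [n] generators; [projection n] retracts [wedge(oo)] onto it by killing
    the others. *)
Definition inclusion n : graded_hom k 'I_n nat :=
  substitution k (@inclusion_monotone n).
Definition projection n : graded_hom k nat 'I_n :=
  substitution k (@projection_monotone n).

Lemma inclusionK n : cancel (inclusion n) (projection n).
Proof.
move=> f; rewrite [LHS]substitute_comp; apply: substitute_fix => A i _ _ /=.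
exact: valK.
Qed.

Lemma inclusion_projection n (f : grassmann k nat) :
  (forall A i, A \in msupp f -> i \in A -> (i < n)%N) ->
  inclusion n (projection n f) = f.
Proof.
move=> fn; rewrite [LHS]substitute_comp; apply: substitute_fix => A i fA iA.
by rewrite insubT ?(fn _ _ fA iA).
Qed.

Lemma truncate_inclusion m n f : (m <= n)%N ->
  inclusion n (projection n (inclusion m f)) = inclusion m f.
Proof.
move=> mn; rewrite [X in inclusion n X]substitute_comp [LHS]substitute_comp.
congr (substitute _ f); apply/funext => i /=.
by rewrite insubT //= (leq_trans (ltn_ord i) mn).
Qed.

(** The finitely many elements that span the range involve finitely many
    generators. *)
Lemma einf_range (f : einf k) :
  exists n, forall x, inclusion n (projection n (f x)) = f x.
Proof.
have [s fs] := einf_finite f.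
have [n sn] : exists n, forall g, g \in s ->
    forall A i, A \in msupp g -> i \in A -> (i < n)%N.
  exists (\max_(g <- s) \max_(A <- msupp g) \max_(i <- A) i.+1)%N.
  move=> g gs A i gA iA.
  apply: leq_trans (leq_bigmax_seq _ gs isT).
  apply: leq_trans (leq_bigmax_seq _ gA isT).
  exact: leq_trans (leq_bigmax_seq _ iA isT).
exists n => x; have [c ->] := fs x.
rewrite (graded_hom_sum (projection n)) (graded_hom_sum (inclusion n)).
apply: eq_bigr => i _; rewrite (graded_homZ (projection n)).
rewrite (graded_homZ (inclusion n)) inclusion_projection //.
by apply: sn; rewrite mem_nth.
Qed.

(** [wedge(n)] is spanned by its [2 ^ n] monomials, so every endomorphism of
    [wedge(oo)] that factors through it belongs to the semigroup. *)
Lemma inclusion_finite n (h : graded_hom k nat 'I_n) :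
  finite_dim_range (graded_comp (inclusion n) h).
Proof.
pose T : {fset 'I_n} := seq_fset tt (enum 'I_n).
pose P : seq {fset 'I_n} := fpowerset T.
exists [seq inclusion n (mkmalgU A 1) | A <- P] => x.
exists (fun i => mcoeff (nth fset0 P i) (h x)).
have hx : h x =
    \sum_(A <- P) mcoeff A (h x) *: (mkmalgU A 1 : grassmann k 'I_n).
  rewrite [LHS](@monalgEw _ _ _ (fpowerset T)).
    by apply: eq_bigr => A _; rewrite grassmann_scaleU mulr1.
  apply/fsubsetP => A _; rewrite fpowersetE; apply/fsubsetP => i _.
  by rewrite seq_fsetE mem_enum.
set s := map _ _.
rewrite -(big_mkord xpredT (fun i => mcoeff (nth fset0 P i) (h x) *: s`_i)).
rewrite -[LHS]/(inclusion n (h x)) [in LHS]hx (graded_hom_sum (inclusion n)).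
rewrite size_map (big_nth fset0) big_nat [RHS]big_nat; apply: eq_bigr => i iP.
by rewrite (graded_homZ (inclusion n)) (nth_map fset0).
Qed.
End Truncations.

(** * Strict isomorphism onto a full image *)

Section StrictIsomorphism.

(** Two functors that agree on objects only up to propositional equality have
    arrows in different types; bundling an arrow with its source and target allows
    such arrows to be compared without transports. *)
Definition arrow (C : category) := {xy : C * C & hom xy.1 xy.2}.

Definition to_arrow (C : category) (x y : C) (f : hom x y) : arrow C :=
  existT (fun xy : C * C => hom xy.1 xy.2) (x, y) f.

Lemma to_arrow_objects (C : category) (x y x' y' : C) (f : hom x y)
    (f' : hom x' y') :
  to_arrow f = to_arrow f' -> (x, y) = (x', y').
Proof. exact: (congr1 (@projT1 _ _)). Qed.

Lemma to_arrow_inj (C : category) (x y : C) : injective (@to_arrow C x y).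
Proof. by move=> f f'; exact: inj_pair2. Qed.

Lemma to_arrow_comp (C : category) (x y z x' y' z' : C)
    (g : hom y z) (f : hom x y) (g' : hom y' z') (f' : hom x' y') :
  to_arrow g = to_arrow g' -> to_arrow f = to_arrow f' ->
  to_arrow (compm g f) = to_arrow (compm g' f').
Proof.
move=> gg' ff'; have [? zz'] := to_arrow_objects gg'; subst y' z'.
have [xx'] := to_arrow_objects ff'; subst x'.
by rewrite (to_arrow_inj gg') (to_arrow_inj ff').
Qed.

Lemma to_arrow_id (C : category) (x x' : C) :
  x = x' -> to_arrow (idm x) = to_arrow (idm x').
Proof. by move->. Qed.

Lemma functor_eq (C D : category) (F G : functor C D) :
  (forall x y (f : hom x y),
    to_arrow (map_hom F f) = to_arrow (map_hom G f)) -> F = G.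
Proof.
move=> FG; have obFG : map_obj F = map_obj G.
  by apply/funext => x; have [] := to_arrow_objects (FG x x (idm x)).
case: F G obFG FG => [F0 F1 Fi Fc] [G0 G1 Gi Gc] /= obFG; subst G0 => FG.
have {FG} F1G1 : F1 = G1.
  apply: functional_extensionality_dep => x.
  apply: functional_extensionality_dep => y.
  by apply/funext => f; apply: to_arrow_inj; exact: FG.
by subst G1; congr Functor; exact: Prop_irrelevance.
Qed.

Lemma full_subcategory_to_arrow (D : category) (P : D -> Prop)
    (x y x' y' : full_subcategory P) (f : hom x y) (f' : hom x' y') :
  @to_arrow D (sval x) (sval y) f = @to_arrow D (sval x') (sval y') f' ->
  to_arrow f = to_arrow f'.
Proof.
case: x y x' y' f f' => [x px] [y py] [x' px'] [y' py'] f f' ff'.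
have [? ?] := to_arrow_objects ff'; subst x' y'.
rewrite (Prop_irrelevance px' px) (Prop_irrelevance py' py) in f' ff' *.
by congr to_arrow; exact: to_arrow_inj ff'.
Qed.

Section FullyFaithful.
Context (C D : category) (F : functor C D).
Hypothesis F_full : forall x y (g : hom (F x) (F y)), exists f, map_hom F f = g.
Hypothesis F_faithful : forall x y, injective (@map_hom C D F x y).
Hypothesis F_inj : forall x y, F x = F y -> x = y.

Let image (y : D) : Prop := exists x, F x = y.
Let S := full_subcategory image.

Lemma faithful_to_arrow (x y x' y' : C) (f : hom x y) (f' : hom x' y') :
  to_arrow (map_hom F f) = to_arrow (map_hom F f') -> to_arrow f = to_arrow f'.
Proof.
move=> ff'; have [/F_inj ? /F_inj ?] := to_arrow_objects ff'; subst x' y'.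
by congr to_arrow; apply: F_faithful; exact: to_arrow_inj ff'.
Qed.

Program Definition corestriction : functor C S :=
  @Functor C S (fun x => exist image (F x) (ex_intro _ x erefl))
    (fun x y f => map_hom F f) _ _.
Next Obligation. by move=> x; exact: map_id. Qed.
Next Obligation. by move=> x y z g f; exact: map_comp. Qed.

(** Being injective on objects is what makes this an isomorphism rather than an
    equivalence: the preimage of an object is then the only one, so the chosen
    inverse is strict on both sides. *)
Theorem isomorphic_full_image : isomorphic C S.
Proof.
have /choice[G0 G0P] (y : S) : exists x, F x = sval y by exact: svalP y.
have G1_ex (y y' : S) (g : hom y y') : {f : hom (G0 y) (G0 y') |
    to_arrow (map_hom F f) = @to_arrow D (sval y) (sval y') g}.
  apply: cid; case: y y' g (G0P y) (G0P y') => [y py] [y' py'] /= g.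
  move: (G0 _) (G0 _) => x x' xy xy'; subst y y'.
  by have [f <-] := F_full g; exists f.
pose G1 y y' g := sval (G1_ex y y' g).
have G1P y y' g : to_arrow (map_hom F (G1 y y' g)) =
    @to_arrow D (sval y) (sval y') g by exact: svalP (G1_ex y y' g).
have Gid y : G1 y y (idm y) = idm (G0 y).
  apply: F_faithful; apply: to_arrow_inj; rewrite G1P map_id.
  by apply: to_arrow_id; rewrite G0P.
have Gcomp x y z (g : hom y z) (f : hom x y) :
    G1 x z (compm g f) = compm (G1 y z g) (G1 x y f).
  apply: F_faithful; apply: to_arrow_inj; rewrite G1P map_comp.
  by apply: to_arrow_comp; rewrite G1P.
pose G := @Functor S C G0 G1 Gid Gcomp.
exists corestriction, G; split; apply: functor_eq => x y f.
  by apply: faithful_to_arrow; exact: G1P.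
apply: full_subcategory_to_arrow; exact: G1P.
Qed.

End FullyFaithful.
End StrictIsomorphism.

(** * Sequences of sets as sets *)

Section Coding.

Definition hset_image (A : Type) (F : A -> hset) : hset :=
  sval (cid (hset_range F)).

Lemma hset_imageP (A : Type) (F : A -> hset) x :
  hmem x (hset_image F) <-> exists a, F a = x.
Proof. exact: (svalP (cid (hset_range F))). Qed.

Definition upair (x y : hset) := hset_image (fun b : bool => if b then x else y).

Lemma upairP x y z : hmem z (upair x y) <-> z = x \/ z = y.
Proof.
rewrite hset_imageP.
by split=> [[[] <-]|[] ->]; [left|right|exists true|exists false].
Qed.

Lemma upair_inj x y x' y' : upair x y = upair x' y' ->
  (x = x' /\ y = y') \/ (x = y' /\ y = x').
Proof.
move=> xyE; have E z : (z = x \/ z = y) <-> (z = x' \/ z = y').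
  by rewrite -!upairP xyE.
have [] := (E x).1 (or_introl erefl) => ?; subst x;
have [] := (E y).1 (or_intror erefl) => ?; subst y; [|by left|by right|].
  by have [] := (E y').2 (or_intror erefl) => ->; left.
by have [] := (E x').2 (or_introl erefl) => ->; left.
Qed.

(** Kuratowski pair. *)
Definition hpair x y := upair (upair x x) (upair x y).

Lemma hpair_inj x y x' y' : hpair x y = hpair x' y' -> x = x' /\ y = y'.
Proof.
move=> /upair_inj[] [/upair_inj xE /upair_inj yE].
  by split; intuition congruence.
by split; intuition congruence.
Qed.

Lemma hset_nat : exists num : nat -> hset, injective num.
Proof.
have [X [F [G FK _]]] := every_type_is_a_set nat.
exists (sval \o F); apply: inj_comp (can_inj FK) => -[x p] [y q].
exact: eq_exist.
Qed.

Definition numeral : nat -> hset := sval (cid hset_nat).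

Lemma numeral_inj : injective numeral.
Proof. exact: (svalP (cid hset_nat)). Qed.

(** The graph of the sequence, as a set of pairs. *)
Definition sequence_code (s : nat -> hset) : hset :=
  hset_image (fun n => hpair (numeral n) (s n)).

Lemma sequence_code_inj : injective sequence_code.
Proof.
move=> s t st; apply/funext => n.
have /hset_imageP[m] : hmem (hpair (numeral n) (s n)) (sequence_code t).
  by rewrite -st; apply/hset_imageP; exists n.
by move=> /hpair_inj[/numeral_inj -> ->].
Qed.

(** Replacement for a countable family of sets.  The type of the elements of a set
    is as large as [hset] itself, so [hset_range] does not apply to it; each [X n]
    has to be enumerated by the small type of branches of a tree first. *)
Lemma hset_bigcup_image (X : nat -> hset)
    (F : forall n, {x | hmem x (X n)} -> hset) :
  exists Z, forall z, hmem z Z <-> exists n x, F n x = z.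
Proof.
have /choice[t tX] n : exists t, X n = hset_of t by exact: hset_of_surj.
(* Branches of a tree representing [X n]; [e] below enumerates its elements. *)
pose A n := let: Sup B _ := t n in B.
have el n : {e : A n -> {x | hmem x (X n)} | forall x, exists a, e a = x}.
  apply: cid; rewrite /A; move: (tX n) (F n) => + _; case: (t n) => B f XE.
  have Xf b : hmem (hset_of (f b)) (X n) by rewrite XE; apply/hmemE; exists b.
  exists (fun b => exist (fun x => hmem x (X n)) _ (Xf b)) => -[x xX].
  have /hmemE[b xb] : hmem x (hset_of (Sup f)) by rewrite -XE.
  by exists b; exact: eq_exist.
exists (hset_image (fun a : {n & A n} =>
  F (tag a) (sval (el (tag a)) (tagged a)))).
move=> z; rewrite hset_imageP; split=> [[a <-]|[n [x <-]]]; first by do 2 eexists.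
by have [a ax] := svalP (el n) x; exists (Tagged A a); rewrite /= ax.
Qed.

End Coding.

(** * The value of a functor at the infinite Grassmann algebra *)

Local Open Scope classical_set_scope.

Section Colimit.
Context (k : fieldType) (F : virtual_superspace_category k).

Definition space_at (n : nat) : space := F n.

Definition map_at m n (h : graded_hom k 'I_m 'I_n) :
    continuousType (points (space_at m)) (points (space_at n)) :=
  map_hom F (x := m) (y := n) h.

Lemma map_at_comp m n p (g : graded_hom k 'I_n 'I_p) (h : graded_hom k 'I_m 'I_n)
    (x : space_at m) :
  map_at g (map_at h x) = map_at (graded_comp g h) x.
Proof.
have := @map_comp _ _ F m n p g h.
by move=> /(congr1 (fun f : continuousType _ _ => f x)).
Qed.

Lemma map_at_id m (h : graded_hom k 'I_m 'I_m) (x : space_at m) :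
  h =1 id -> map_at h x = x.
Proof.
move=> hid; have -> : h = graded_id k 'I_m by exact: graded_homP.
have := @map_id _ _ F m.
by move=> /(congr1 (fun f : continuousType _ _ => f x)).
Qed.

Lemma eq_map_at m n (g h : graded_hom k 'I_m 'I_n) (x : space_at m) :
  g =1 h -> map_at g x = map_at h x.
Proof. by move=> gh; rewrite (graded_homP gh). Qed.

Definition transition m n : graded_hom k 'I_m 'I_n :=
  graded_comp (projection k n) (inclusion k m).

(** The point of the colimit represented by [y] is recorded by its images under all
    the retractions to the finite stages.  The coordinate of index [m] is [y]
    itself, so that the stages of [F] can be read off from the points. *)
Definition coordinates m (y : space_at m) : hset :=
  sequence_code (fun n => sval (map_at (transition m n) y)).

Definition colim_carrier : hset :=
  sval (cid (hset_bigcup_image coordinates)).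

Lemma colim_carrierP z :
  hmem z colim_carrier <-> exists m (y : space_at m), coordinates y = z.
Proof. exact: (svalP (cid (hset_bigcup_image coordinates))). Qed.

Definition colim_in0 m (y : space_at m) : {x | hmem x colim_carrier} :=
  exist (fun x => hmem x colim_carrier) (coordinates y)
    ((colim_carrierP _).2 (ex_intro _ m (ex_intro _ y erefl))).

(** The final topology for the maps from the stages. *)
Definition colim_open (U : set {x | hmem x colim_carrier}) : Prop :=
  forall m, open (@colim_in0 m @^-1` U).

Lemma colim_openT : colim_open setT.
Proof. by move=> m; rewrite preimage_setT; exact: openT. Qed.

Lemma colim_openI : setI_closed colim_open.
Proof. by move=> U V oU oV m; rewrite preimage_setI; exact: openI. Qed.

Lemma colim_open_bigU (I : Type) (U : I -> set {x | hmem x colim_carrier}) :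
  (forall i, colim_open (U i)) -> colim_open (\bigcup_i U i).
Proof.
by move=> oU m; rewrite preimage_bigcup; apply: bigcup_open => i _; exact: oU.
Qed.

Definition colim : space := Space colim_openT colim_openI colim_open_bigU.

Definition colim_in m (y : space_at m) : colim := colim_in0 y.

Lemma colim_in_surj (x : colim) : exists my : {m & space_at m},
  colim_in (tagged my) = x.
Proof.
case: x => x xX; have /colim_carrierP[m [y yx]] := xX.
by exists (Tagged (fun m => space_at m) y); exact: eq_exist.
Qed.

Lemma colim_ind (P : colim -> Prop) :
  (forall m (y : space_at m), P (colim_in y)) -> forall x, P x.
Proof. by move=> PP x; have [[m y] <-] := colim_in_surj x. Qed.

Lemma colim_in_eq m m' (y : space_at m) (y' : space_at m') :
  colim_in y = colim_in y' <->
  forall n, map_at (transition m n) y = map_at (transition m' n) y'.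
Proof.
split=> [/(congr1 sval)/sequence_code_inj yy' n|yy'].
  have /= := congr1 (fun s => s n) yy'.
  case: (map_at _ y) (map_at _ y') => [x p] [x' p'] /=; exact: eq_exist.
apply: eq_exist; congr sequence_code; apply/funext => n; by rewrite yy'.
Qed.

Lemma transition_refl n : transition n n =1 id.
Proof. exact: inclusionK. Qed.

(** What makes evaluation below independent of the representative: if [m <= m'],
    then [y'] is the image of [y] under the inclusion of [wedge(m)] in [wedge(m')],
    because [colim_in y] has [y'] as its coordinate of index [m']. *)
Lemma colim_in_map_eq m m' (y : space_at m) (y' : space_at m') n
    (g : graded_hom k nat 'I_n) :
  colim_in y = colim_in y' ->
  map_at (graded_comp g (inclusion k m)) y =
  map_at (graded_comp g (inclusion k m')) y'.
Proof.
wlog mm' : m m' y y' / (m <= m')%N.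
  by case: (leqP m m') => [|/ltnW] mm' W /esym E; [|symmetry]; apply: W => //.
move=> /colim_in_eq/(_ m'); rewrite [RHS]map_at_id; last exact: transition_refl.
move=> <-; rewrite map_at_comp; apply: eq_map_at => x.
by rewrite !graded_compE truncate_inclusion.
Qed.

(** The colimit behaves like the value of [F] at [wedge(oo)]; this is the value of
    [F] at [g].  The retractions onto the stages are instances of it, and the
    action of the semigroup is defined by it. *)
Definition colim_eval n (g : graded_hom k nat 'I_n) (x : colim) : space_at n :=
  let my := sval (cid (colim_in_surj x)) in
  map_at (graded_comp g (inclusion k (tag my))) (tagged my).

Lemma colim_eval_in n (g : graded_hom k nat 'I_n) m (y : space_at m) :
  colim_eval g (colim_in y) = map_at (graded_comp g (inclusion k m)) y.
Proof.
by apply: colim_in_map_eq; exact: (svalP (cid (colim_in_surj (colim_in y)))).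
Qed.

Lemma map_colim_eval m n (h : graded_hom k 'I_m 'I_n)
    (g : graded_hom k nat 'I_m) x :
  map_at h (colim_eval g x) = colim_eval (graded_comp h g) x.
Proof.
elim/colim_ind: x => l y; rewrite !colim_eval_in map_at_comp.
exact: eq_map_at.
Qed.

Lemma eq_colim_eval n (g h : graded_hom k nat 'I_n) x :
  g =1 h -> colim_eval g x = colim_eval h x.
Proof. by move=> gh; rewrite (graded_homP gh). Qed.

Definition coordinate n := colim_eval (projection k n).

Lemma coordinate_in n (y : space_at n) : coordinate n (colim_in y) = y.
Proof.
by rewrite /coordinate colim_eval_in map_at_id //; exact: transition_refl.
Qed.

(** A point is determined by its coordinates.  The identities between maps to a
    colimit are all checked in this way. *)
Lemma colim_ext x x' : (forall n, coordinate n x = coordinate n x') -> x = x'.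
Proof.
elim/colim_ind: x => m y; elim/colim_ind: x' => m' y' yy'.
by apply/colim_in_eq => n; have := yy' n; rewrite /coordinate !colim_eval_in.
Qed.

Lemma sval_colim (x : colim) :
  sval x = sequence_code (fun n => sval (coordinate n x)).
Proof.
elim/colim_ind: x => m y; congr sequence_code; apply/funext => n.
by rewrite /coordinate colim_eval_in.
Qed.

Lemma colim_openP (U : set colim) :
  open U <-> forall m, open (@colim_in m @^-1` U).
Proof. by []. Qed.

Lemma colim_in_continuous m : continuous (@colim_in m).
Proof.
by apply/continuousP => U /colim_openP; exact.
Qed.

Lemma colim_continuous (Z : topologicalType) (f : colim -> Z) :
  (forall m, continuous (f \o @colim_in m)) -> continuous f.
Proof.
move=> fc; apply/continuousP => U oU; apply/colim_openP => m.
by have /continuousP fmc := fc m; exact: fmc U oU.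
Qed.

Lemma colim_eval_continuous n (g : graded_hom k nat 'I_n) :
  continuous (colim_eval g).
Proof.
apply: colim_continuous => m.
have -> : colim_eval g \o @colim_in m = map_at (graded_comp g (inclusion k m)).
  by apply/funext => y; exact: colim_eval_in.
exact: cts_fun.
Qed.

(** Some [n] with [f] taking values in [wedge(n)].  Any other choice gives the same
    action, as [colim_eval_act] shows. *)
Definition einf_level (f : einf k) : nat := sval (cid (einf_range f)).

Lemma einf_levelP (f : einf k) x :
  inclusion k (einf_level f) (projection k (einf_level f) (f x)) = f x.
Proof. exact: (svalP (cid (einf_range f))). Qed.

Definition colim_act0 (f : einf k) (x : colim) : colim :=
  colim_in (colim_eval (graded_comp (projection k (einf_level f)) f) x).

Lemma colim_act_continuous f : continuous (colim_act0 f).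
Proof.
move=> x; apply: continuous_comp; first exact: colim_eval_continuous.
exact: colim_in_continuous.
Qed.

Definition colim_act f : continuousType (points colim) (points colim) :=
  mkcts (@colim_act_continuous f).

(** This determines the action, through [colim_ext], without mention of a level;
    it holds because truncating at the level of [f] does not change [f]. *)
Lemma colim_eval_act n (g : graded_hom k nat 'I_n) f x :
  colim_eval g (colim_act f x) = colim_eval (graded_comp g f) x.
Proof.
rewrite [LHS]colim_eval_in map_colim_eval; apply: eq_colim_eval => y.
by rewrite !graded_compE einf_levelP.
Qed.

Lemma colim_act_comp g h x :
  colim_act (einf_comp g h) x = colim_act g (colim_act h x).
Proof.
apply: colim_ext => n; rewrite /coordinate !colim_eval_act.
exact: eq_colim_eval.
Qed.

Definition colim_einf_space : einf_space k := EinfSpace colim_act_comp.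

End Colimit.

(** * Full faithfulness *)

Lemma comp_continuous (X Y Z : topologicalType) (f : X -> Y) (g : Y -> Z) :
  continuous f -> continuous g -> continuous (g \o f).
Proof. by move=> fc gc x; apply: continuous_comp; [exact: fc|exact: gc]. Qed.

Section FiniteLevelAction.
Context (k : fieldType) (F : virtual_superspace_category k).

(** The endomorphism [inclusion n \o h \o projection m] of [wedge(oo)]: the
    semigroup contains every homomorphism between finite stages. *)
Definition einf_of m n (h : graded_hom k 'I_m 'I_n) : einf k :=
  Einf (inclusion_finite (graded_comp h (projection k m))).

(** Both the projector onto a stage ([h] the identity) and the value of [F] at any
    [h] are actions of elements of the semigroup.  Hence equivariant maps preserve
    the stages and are natural there, and the action determines [F] on arrows. *)
Lemma colim_act_einf_of m n (h : graded_hom k 'I_m 'I_n) (x : colim F) :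
  colim_act _ (einf_of h) x = colim_in (map_at _ h (coordinate m x)).
Proof.
apply: colim_ext => p; rewrite [LHS]colim_eval_act [RHS]colim_eval_in.
by rewrite /coordinate !map_colim_eval; exact: eq_colim_eval.
Qed.

End FiniteLevelAction.

Section Morphisms.
Context (k : fieldType) (F G : virtual_superspace_category k).

Definition component_at (t : nat_trans F G) n :
  continuousType (points (space_at F n)) (points (space_at G n)) :=
  component t n.

Lemma component_map_at (t : nat_trans F G) m n (h : graded_hom k 'I_m 'I_n)
    (x : space_at F m) :
  component_at t n (map_at _ h x) = map_at _ h (component_at t m x).
Proof.
have := @naturality _ _ _ _ t m n h.
by move=> /(congr1 (fun f : continuousType _ _ => f x)).
Qed.

Section ColimMap.
Variable t : nat_trans F G.

Definition colim_map0 (x : colim F) : colim G :=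
  let my := sval (cid (colim_in_surj x)) in
  colim_in (component_at t (tag my) (tagged my)).

Lemma colim_eval_map n (g : graded_hom k nat 'I_n) x :
  colim_eval g (colim_map0 x) = component_at t n (colim_eval g x).
Proof. by rewrite [LHS]colim_eval_in -component_map_at. Qed.

Lemma colim_map_in m (y : space_at F m) :
  colim_map0 (colim_in y) = colim_in (component_at t m y).
Proof.
apply: colim_ext => n; rewrite [LHS]colim_eval_map [RHS]colim_eval_in.
by rewrite -component_map_at colim_eval_in.
Qed.

Lemma colim_map_continuous : continuous colim_map0.
Proof.
apply: colim_continuous => m.
have -> : colim_map0 \o @colim_in _ F m = @colim_in _ G m \o component_at t m.
  by apply/funext => y; exact: colim_map_in.
move=> y; apply: continuous_comp; first exact: cts_fun.
exact: colim_in_continuous.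
Qed.

Definition colim_map : continuousType (points (colim F)) (points (colim G)) :=
  mkcts colim_map_continuous.

Lemma colim_map_equivariant (f : einf k) (x : colim F) :
  colim_map (colim_act _ f x) = colim_act _ f (colim_map x).
Proof.
apply: colim_ext => n.
by rewrite [LHS]colim_eval_map [RHS]colim_eval_act colim_eval_map colim_eval_act.
Qed.

Definition colim_einf_map : einf_map (colim_einf_space F) (colim_einf_space G) :=
  @EinfMap k (colim_einf_space F) (colim_einf_space G) colim_map
    colim_map_equivariant.

Lemma coordinate_colim_map n x :
  coordinate n (colim_einf_map x) = component_at t n (coordinate n x).
Proof. exact: colim_eval_map. Qed.

End ColimMap.

(** Each stage is a retract of the colimit, so a natural transformation is
    visible in the induced map. *)
Lemma colim_einf_map_faithful (s t : nat_trans F G) :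
  colim_einf_map s = colim_einf_map t -> s = t.
Proof.
move=> st; apply: nat_transP => n; apply/continuousEP => y.
have := coordinate_colim_map s n (colim_in y).
by rewrite st coordinate_colim_map coordinate_in => /esym.
Qed.

(** The transformation at stage [n] is [phi] between the section [colim_in] and the
    retraction [coordinate n], which are both continuous. *)
Lemma colim_einf_map_full
    (phi : einf_map (colim_einf_space F) (colim_einf_space G)) :
  exists t : nat_trans F G, colim_einf_map t = phi.
Proof.
have phi_act (f : einf k) (x : colim F) :
  phi (colim_act _ f x) = colim_act _ f (phi x) by exact: (einf_equivariant phi).
have phi_in m n (h : graded_hom k 'I_m 'I_n) (y : space_at F m) :
    phi (colim_in (map_at _ h y)) =
    colim_in (map_at _ h (coordinate m (phi (colim_in y)))).
  by rewrite -(coordinate_in y) -!colim_act_einf_of phi_act !coordinate_in.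
pose t0 n (y : space_at F n) : space_at G n := coordinate n (phi (colim_in y)).
have t0_cts n : continuous (t0 n).
  exact: (comp_continuous (comp_continuous (@colim_in_continuous _ F n)
    (@cts_fun _ _ phi)) (@colim_eval_continuous _ G n (projection k n))).
pose t1 (n : grassmann_category k) : @hom top_category (F n) (G n) :=
  mkcts (t0_cts n).
have t1_nat (m n : grassmann_category k) (h : hom m n) :
    compm (t1 n) (map_hom F h) = compm (map_hom G h) (t1 m).
  apply/continuousEP => y; rewrite /= -[LHS]/(t0 n (map_at _ h y)).
  by rewrite /t0 phi_in coordinate_in.
exists (NatTrans t1_nat); apply: einf_mapP => x; apply: colim_ext => n.
(* [colim_in (coordinate n x)] is the action on [x] of the projector onto
   [wedge(n)], so [phi] commutes with its formation. *)
rewrite coordinate_colim_map -[LHS]/(t0 n (coordinate n x)) /t0.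
have id1 : graded_id k 'I_n =1 id by [].
by rewrite -[coordinate n x](map_at_id _ id1) -colim_act_einf_of phi_act
  colim_act_einf_of coordinate_in map_at_id.
Qed.

End Morphisms.

Section ColimFunctor.
Context (k : fieldType).

Program Definition colim_functor :
    functor (virtual_superspace_category k) (einf_space_category k) :=
  @Functor (virtual_superspace_category k) (einf_space_category k)
    (@colim_einf_space k) (fun F G t => colim_einf_map t) _ _.
Next Obligation.
move=> F; apply: einf_mapP => x; apply: colim_ext => n.
by rewrite coordinate_colim_map.
Qed.
Next Obligation.
move=> F G H t s; apply: einf_mapP => x; apply: colim_ext => n.
rewrite coordinate_colim_map.
rewrite -[RHS]/(coordinate n (colim_einf_map t (colim_einf_map s x))).
by rewrite !coordinate_colim_map.
Qed.

End ColimFunctor.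

(** * Recovery of the functor from its colimit *)

Section Recovery.

Lemma points_eq (S : space) (x y : S) : sval x = sval y -> x = y.
Proof. by case: x y => [x p] [y q] /=; exact: eq_exist. Qed.

Lemma space_eq (S T : space) (f : S -> T) (g : T -> S) :
  continuous f -> continuous g ->
  (forall x, sval (f x) = sval x) -> (forall y, sval (g y) = sval y) -> S = T.
Proof.
move=> /continuousP fc /continuousP gc fv gv.
have ST : carrier S = carrier T.
  apply: hset_ext => z; split=> zz.
    by rewrite -[z](fv (exist _ z zz)); exact: (svalP (f _)).
  by rewrite -[z](gv (exist _ z zz)); exact: (svalP (g _)).
case: S T f g fc gc fv gv ST => [X oX oXT oXI oXU] [Y oY oYT oYI oYU] /=.
move=> f g fc gc fv gv XY; subst Y.
have fE : f = id by apply/funext => x; exact/points_eq/fv.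
have gE : g = id by apply/funext => x; exact/points_eq/gv.
have oXY : oX = oY.
  apply/funext => U; apply/propext; split=> oU.
    by have := gc U oU; rewrite gE.
  by have := fc U oU; rewrite fE.
by subst oY; congr Space; exact: Prop_irrelevance.
Qed.

Lemma top_to_arrow (S T S' T' : space) (f : @hom top_category S T)
    (f' : @hom top_category S' T') :
  S = S' -> T = T' ->
  (forall (x : S) (x' : S'), sval x = sval x' -> sval (f x) = sval (f' x')) ->
  to_arrow f = to_arrow f'.
Proof.
move=> ? ?; subst S' T' => ff'; congr to_arrow; apply/continuousEP => x.
exact/points_eq/ff'.
Qed.

Context (k : fieldType).

Lemma einf_space_eq_transport (X Y : einf_space k) : X = Y ->
  exists phi : X -> Y, [/\ continuous phi, forall x, sval (phi x) = sval x &
    forall f x, phi (act X f x) = act Y f (phi x)].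
Proof. by move=> ->; exists id; split=> // x; exact: cvg_id. Qed.

(** An equality of colimits gives comparison maps between the stages, which
    do not change the elements: the coordinates are encoded in the set that a
    point of the colimit is. *)
Lemma colim_transport (F G : virtual_superspace_category k) :
  colim_einf_space F = colim_einf_space G ->
  exists psi : forall n, space_at F n -> space_at G n,
    [/\ forall n, continuous (psi n), forall n x, sval (psi n x) = sval x &
      forall m n (h : graded_hom k 'I_m 'I_n) x,
        psi n (map_at _ h x) = map_at _ h (psi m x)].
Proof.
move=> /einf_space_eq_transport[phi [phi_cts phi_val phi_act]].
have phi_coord n x : sval (coordinate n (phi x)) = sval (coordinate n x).
  have := phi_val x; rewrite !sval_colim => /sequence_code_inj.
  exact: (congr1 (fun s => s n)).
exists (fun n y => coordinate n (phi (colim_in y))); split=> [n|n y|m n h y].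
- exact: (comp_continuous (comp_continuous (@colim_in_continuous _ F n)
    phi_cts) (@colim_eval_continuous _ G n (projection k n))).
- by rewrite phi_coord coordinate_in.
have -> : colim_in (map_at _ h y) = colim_act _ (einf_of h) (colim_in y).
  by rewrite colim_act_einf_of coordinate_in.
have /= -> := phi_act (einf_of h) (colim_in y).
by rewrite colim_act_einf_of coordinate_in.
Qed.

(** The comparison maps in both directions are the identity on elements and
    continuous, so corresponding stages have the same points and the same open
    sets; naturality then gives the same arrows. *)
Lemma colim_einf_space_inj : injective (@colim_einf_space k).
Proof.
move=> F G FG.
have [f [f_cts f_val f_nat]] := colim_transport FG.
have [g [g_cts g_val g_nat]] := colim_transport (esym FG).
have FGn n : space_at F n = space_at G n by exact: (@space_eq _ _ (f n) (g n)).
apply: functor_eq => m n h; apply: top_to_arrow; [exact: FGn|exact: FGn|].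
move=> y y' yy'; have -> : y' = f m y.
  by apply: points_eq; rewrite f_val.
by rewrite -[RHS]/(sval (map_at _ h (f m y))) -f_nat f_val.
Qed.

End Recovery.

(** * The isomorphism *)

Theorem theorem8p6 (k : fieldType) :
  exists P : einf_space_category k -> Prop,
    isomorphic (virtual_superspace_category k)
               (full_subcategory (C := einf_space_category k) P).
Proof.
exists (fun X => exists F, colim_functor k F = X).
apply: isomorphic_full_image.
- exact: colim_einf_map_full.
- exact: colim_einf_map_faithful.
- exact: colim_einf_space_inj.
Qed.
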